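(* Consider left modules over rings with unity $1\neq0$ that are not fields (the ring being allowed to vary). The class of left $\mathrm{SM}$ modules properly contains each of the following classes: the class of Artinian modules, the class of locally finite modules, and the class of modules of finite length. That is, every left module that is Artinian, or locally finite, or of finite length is an $\mathrm{SM}$ module; and for each of these three classes there exist a ring $R$ and a left $R$-module that is an $\mathrm{SM}$ module but does not belong to that class.
   Context: A left $R$-module $M$ is an $\mathrm{SM}$ module if every nontrivial (i.e. nonzero) submodule of $M$ contains a simple submodule. A module is locally finite if each of its finitely generated submodules is a finite set. *)

(* Defs.v *)
From HB Require Import structures.
From mathcomp Require Import all_boot all_order all_algebra.
From mathcomp Require Import boolp classical_sets functions cardinality.

Set Implicit Arguments.
Unset Strict Implicit.
Unset Printing Implicit Defensive.

Import GRing.Theory.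

Local Open Scope ring_scope.
Local Open Scope classical_set_scope.

Definition is_field (R : nzRingType) : Prop :=
  (forall x y : R, x * y = y * x) /\
  (forall x : R, x <> 0 -> exists y : R, x * y = 1).

Section Modules.
Context {R : nzRingType} {M : lmodType R}.
Implicit Types N S T : set M.

(* Submodules are classical (not necessarily decidable) subsets of M. *)
Definition submodule N : Prop := GRing.submod_closed (mem N).

Definition simple_submodule S : Prop :=
  [/\ submodule S, S <> [set 0] &
      forall T, submodule T -> T `<=` S -> T = [set 0] \/ T = S].

Definition finitely_generated N : Prop :=
  exists2 G : set M, finite_set G & N = smallest submodule G.

(* For submodules S of T: the quotient T / S is simple, expressed through the
   correspondence between submodules of T / S and submodules between S and T. *)
Definition simple_factor S T : Prop :=
  S `<` T /\
  forall N, submodule N -> S `<=` N -> N `<=` T -> N = S \/ N = T.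

End Modules.

Definition SM (R : nzRingType) (M : lmodType R) : Prop :=
  forall N : set M, submodule N -> N <> [set 0] ->
    exists2 S : set M, simple_submodule S & S `<=` N.

Definition artinian (R : nzRingType) (M : lmodType R) : Prop :=
  forall N : nat -> set M,
    (forall k, submodule (N k)) -> (forall k, N k.+1 `<=` N k) ->
    exists n, forall k, (n <= k)%N -> N k = N n.

Definition locally_finite (R : nzRingType) (M : lmodType R) : Prop :=
  forall N : set M, finitely_generated N -> finite_set N.

(* M has a composition series; the terms of the sequence beyond n are unused. *)
Definition finite_length (R : nzRingType) (M : lmodType R) : Prop :=
  exists (n : nat) (N : nat -> set M),
    [/\ forall k, (k <= n)%N -> submodule (N k),
        N 0%N = [set 0], N n = setT &
        forall k, (k < n)%N -> simple_factor (N k) (N k.+1)].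

(* Main.v *)
Require Import Defs.
From HB Require Import structures.
From mathcomp Require Import all_boot all_order all_algebra finmap.
From mathcomp Require Import boolp classical_sets functions cardinality.

(** In an Artinian module, and below any element of a locally finite one, one
    cannot keep choosing strictly smaller nonzero submodules, so a simple one
    is reached; a module of finite length is Artinian.  All three inclusions
    are strict because of one example: over a field [K], the regular module of
    the ring [K^nat] is SM, since an ideal containing some [f] with [f n != 0]
    contains the whole [n]-th coordinate axis, which is simple.  However the
    ideals [{f | f i = 0 for i < k}] strictly decrease with [k], and the
    submodule generated by [1] is infinite. *)

Import GRing.Theory.

Local Open Scope ring_scope.
Local Open Scope classical_set_scope.

(** * Submodules and descending chains in an arbitrary module *)

Section Submodules.
Context {R : nzRingType} {M : lmodType R}.
Implicit Types (N S T : set M) (C : nat -> set M).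

(** Frees the closure conditions from the boolean membership [mem], so that later proofs handle
    plain predicates. *)
Lemma submoduleP N :
  submodule N <->
  N 0 /\ forall (a : R) (u v : M), N u -> N v -> N (a *: u + v).
Proof.
split=> [[N0 Nlin]|[N0 Nlin]]; split.
- by rewrite inE in N0.
- move=> a u v Nu Nv.
  by have := Nlin a u v (mem_set Nu) (mem_set Nv); rewrite inE.
- by rewrite inE.
- by move=> a u v; rewrite !inE; exact: Nlin.
Qed.

Lemma submodule_0 N : submodule N -> N 0.
Proof. by move=> /submoduleP[]. Qed.

Lemma submodule_sub N (u v : M) : submodule N -> N u -> N v -> N (u - v).
Proof.
by move=> /submoduleP[_ Nlin] Nu Nv; rewrite addrC -scaleN1r; exact: Nlin.
Qed.

Lemma submodule_add N (u v : M) : submodule N -> N u -> N v -> N (u + v).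
Proof.
by move=> /submoduleP[_ Nlin] Nu Nv; rewrite -[u]scale1r; exact: Nlin.
Qed.

Lemma submodule_scale N (a : R) (u : M) : submodule N -> N u -> N (a *: u).
Proof.
by move=> /submoduleP[N0 Nlin] Nu; rewrite -[_ *: _]addr0; exact: Nlin.
Qed.

Lemma submodule_setI S T : submodule S -> submodule T -> submodule (S `&` T).
Proof.
move=> /submoduleP[S0 Slin] /submoduleP[T0 Tlin]; apply/submoduleP.
by split=> // a u v [Su Tu] [Sv Tv]; split; [exact: Slin|exact: Tlin].
Qed.

Lemma submodule_smallest (G : set M) : submodule (smallest submodule G).
Proof.
apply/submoduleP; split=> [N [/submodule_0]//|a u v Gu Gv N [Nsub GN]].
by have /submoduleP[_] := Nsub; apply; [exact: Gu|exact: Gv].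
Qed.

Definition submodule_sum S T : set M :=
  [set x | exists s t, [/\ S s, T t & x = s + t]].

Lemma submodule_sum_submodule S T :
  submodule S -> submodule T -> submodule (submodule_sum S T).
Proof.
move=> /submoduleP[S0 Slin] /submoduleP[T0 Tlin]; apply/submoduleP; split.
  by exists 0, 0; rewrite addr0.
move=> a _ _ [s [t [Ss Tt ->]]] [s' [t' [Ss' Tt' ->]]].
exists (a *: s + s'), (a *: t + t'); split; [exact: Slin|exact: Tlin|].
by rewrite scalerDr addrACA.
Qed.

Lemma nonzero_submoduleP N :
  submodule N -> N <> [set 0] <-> exists2 x, N x & x <> 0.
Proof.
move=> Nsub; split=> [Nn0|[x Nx xn0] N0]; last by rewrite N0 in Nx.
apply: contrapT => noelt; apply: Nn0; apply/seteqP; split=> x /=.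
  by move=> Nx; apply: contrapT => xn0; apply: noelt; exists x.
by move=> ->; exact: submodule_0.
Qed.

(** Source of the strict descent, both for finite submodules and for Artinian modules. *)
Lemma not_simple_proper N :
  submodule N -> N <> [set 0] -> ~ simple_submodule N ->
  exists T, [/\ submodule T, T <> [set 0] & T `<` N].
Proof.
move=> Nsub Nn0 Nnsimple; apply: contrapT => noT; apply: Nnsimple; split=> //.
move=> T Tsub TN; have [|Tn0] := pselect (T = [set 0]); first by left.
right; apply/seteqP; split=> //; apply: contrapT => NT.
by apply: noT; exists T; split.
Qed.

(** Strong induction on the cardinality: a nonzero submodule that is not simple has a nonzero proper
    submodule, which has fewer elements. *)
Lemma finite_submodule_simple N :
  finite_set N -> submodule N -> N <> [set 0] ->
  exists2 S, simple_submodule S & S `<=` N.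
Proof.
have [n] := ubnP #|` fset_set N|.
elim: n N => // n IHn N; rewrite ltnS => Nn Nfin Nsub Nn0.
have [|Nnsimple] := pselect (simple_submodule N); first by exists N.
have [T [Tsub Tn0 [TN NT]]] := not_simple_proper _ Nsub Nn0 Nnsimple.
have Tfin : finite_set T by exact: sub_finite_set Nfin.
have TNcard : (#|` fset_set T| < #|` fset_set N|)%N.
  apply: fproper_ltn_card; rewrite fproperE; apply/andP.
  by split; [rewrite -fset_set_sub|apply/negP; rewrite -fset_set_sub].
have [S Ssimple ST] := IHn T (leq_trans TNcard Nn) Tfin Tsub Tn0.
by exists S => //; exact: subset_trans TN.
Qed.

Definition eventually_constant C :=
  exists n, forall k, (n <= k)%N -> C k = C n.

Lemma decreasing_subset C :
  (forall k, C k.+1 `<=` C k) ->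
  forall m n, (m <= n)%N -> C n `<=` C m.
Proof.
move=> Cdec m n /subnK <-; elim: (n - m)%N => // d IHd.
by apply: subset_trans IHd; rewrite addSn; exact: Cdec.
Qed.

(** Lets stabilisation climb one step of a composition series. Since [S + (C k]&[T)] lies between
    [S] and [T], simplicity of the factor makes it one of the two for each [k]. *)
Lemma simple_factor_eventually_constant C S T :
  (forall k, submodule (C k)) -> (forall k, C k.+1 `<=` C k) ->
  submodule S -> submodule T -> simple_factor S T ->
  eventually_constant (fun k => C k `&` S) ->
  eventually_constant (fun k => C k `&` T).
Proof.
move=> Csub Cdec Ssub Tsub [[ST _] fac] [n Cn].
have Cle := decreasing_subset _ Cdec.
pose P k := submodule_sum S (C k `&` T).
have PE k : P k = S \/ P k = T.
  apply: fac.
  - by apply: submodule_sum_submodule => //; exact: submodule_setI.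
  - move=> x Sx; exists x, 0; rewrite addr0; split=> //.
    by split; exact: submodule_0.
  - by move=> _ [s [t [Ss [_ Tt] ->]]]; apply: submodule_add => //; exact: ST.
(* If the sum is [S] at [k0], then [C k]&[T] lies in [S] from [k0] on, and the traces on [T] and [S]
   agree. Otherwise the sum is always [T], and elements of [T] can be decomposed. *)
have [[k0 Pk0]|noS] := pselect (exists k, P k = S).
  have CTS k : (k0 <= k)%N -> C k `&` T = C k `&` S.
    move=> k0k; apply/seteqP; split=> x [Ckx].
      move=> Tx; split=> //; rewrite -Pk0; exists 0, x; rewrite add0r.
      by split=> //; [exact: submodule_0|split=> //; exact: Cle Ckx].
    by move=> /ST.
  exists (maxn n k0) => k; rewrite geq_max => /andP[nk k0k].
  by rewrite !CTS ?leq_maxr// Cn// Cn// leq_maxl.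
have {noS PE}PT k : P k = T.
  by have [PS|//] := PE k; case: noS; exists k.
exists n => k nk; apply/seteqP; split=> x [Cx Tx]; split=> //.
  exact: Cle Cx.
have : P k x by rewrite PT.
move=> [s [t [Ss [Ckt Tt] xE]]].
(* modular law: the component [s = x - t] lies in [C n `&` S = C k `&` S] *)
have : (C n `&` S) s.
  split=> //; have -> : s = x - t by rewrite xE addrK.
  by apply: submodule_sub => //; exact: Cle Ckt.
by rewrite -(Cn k nk) xE => -[Cks _]; exact: submodule_add.
Qed.

End Submodules.

(** * The three inclusions *)

Lemma artinian_SM (R : nzRingType) (M : lmodType R) : artinian M -> SM M.
Proof.
move=> art N Nsub Nn0; apply: contrapT => noS.
(* Bundling the invariants in a subtype lets a single choice function be iterated from [N] into an
   infinite strictly decreasing chain. *)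
pose good := {T : set M | [/\ submodule T, T <> [set 0] & T `<=` N]}.
have [f fP] : {f : good -> good & forall T, sval (f T) `<` sval T}.
  apply: (choice (P := fun T U : good => sval U `<` sval T)).
  move=> [T [Tsub Tn0 TN]] /=.
  have Tnsimple : ~ simple_submodule T by move=> Tsimple; apply: noS; exists T.
  have [U [Usub Un0 UT]] := not_simple_proper _ Tsub Tn0 Tnsimple.
  have Ugood : [/\ submodule U, U <> [set 0] & U `<=` N].
    by split=> //; apply: subset_trans TN; exact: properW.
  by exists (exist _ U Ugood).
have N_good : [/\ submodule N, N <> [set 0] & N `<=` N] by split.
pose C k := iter k f (exist _ N N_good).
have Csub k : submodule (sval (C k)) by case: (svalP (C k)).
have Cdec k : sval (C k.+1) `<=` sval (C k) by exact: properW (fP (C k)).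
have [n /(_ n.+1 (leqnSn n)) Cn] := art (fun k => sval (C k)) Csub Cdec.
by have := fP (C n); rewrite -[f _]/(C n.+1) Cn; exact: properxx.
Qed.

Lemma finite_length_artinian (R : nzRingType) (M : lmodType R) :
  finite_length M -> artinian M.
Proof.
move=> [n [N [Nsub N0 Nn Nfac]]] C Csub Cdec.
(* Induction along the composition series: the traces are all zero at [N 0], and at [N n], the whole
   module, they are the chain itself. *)
suff : forall m, (m <= n)%N -> eventually_constant (fun k => C k `&` N m).
  move=> /(_ n (leqnn n)); rewrite Nn => -[k0 Ck0]; exists k0 => k k0k.
  by have := Ck0 k k0k; rewrite !setIT.
elim=> [_|m IHm mn].
  have C0 k : C k `&` [set 0] = [set 0].
    by apply/setIidPr => _ ->; exact: submodule_0.
  by exists 0%N => k _; rewrite N0 !C0.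
apply: (@simple_factor_eventually_constant _ _ C (N m)) => //.
- exact: Nsub (ltnW mn).
- exact: Nsub.
- exact: Nfac.
- exact: IHm (ltnW mn).
Qed.

(** The cyclic submodule generated by a nonzero element of [N] is finite, so the finite case applies
    inside it. *)
Lemma locally_finite_SM (R : nzRingType) (M : lmodType R) :
  locally_finite M -> SM M.
Proof.
move=> lf N Nsub /(nonzero_submoduleP _ Nsub)[x Nx xn0].
pose X := smallest submodule [set x].
have Xfin : finite_set X by apply: lf; exists [set x] => //; exact: finite_set1.
have Xsub : submodule X by exact: submodule_smallest.
have Xn0 : X <> [set 0].
  by apply/(nonzero_submoduleP _ Xsub); exists x => //; exact: sub_gen_smallest.
have [S Ssimple SX] := finite_submodule_simple _ Xfin Xsub Xn0.
by exists S => //; apply: subset_trans SX _; apply: smallest_sub => // _ ->.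
Qed.

(** * The ring of sequences over a field, as a module over itself *)

Section SequenceRing.
Context (K : fieldType).

Let A : nzRingType := nat -> K.

Definition unit_seq (n : nat) : A := fun i => (i == n)%:R.

(** This is the principal ideal generated by the idempotent [unit_seq n]. *)
Definition axis (n : nat) : set A^o := [set g | forall i, i <> n -> g i = 0].

Lemma unit_seq_inj : injective unit_seq.
Proof.
move=> m n /(congr1 (fun g : A => g m)); rewrite /unit_seq eqxx.
by case: eqP => // _ /eqP; rewrite oner_eq0.
Qed.

(** The nonzero sequence [unit_seq 0] vanishes at index 1, hence so does each of its multiples, and
    none is 1. *)
Lemma sequence_ring_not_field : ~ is_field A.
Proof.
move=> [_ /(_ (unit_seq 0))[]].
  move=> /(congr1 (fun g : A => g 0%N)) /eqP.
  by rewrite /unit_seq eqxx oner_eq0.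
move=> y /(congr1 (fun g : A => g 1%N)) /eqP.
by rewrite /unit_seq /= -[(_ * _) _]/(_ * _) mul0r eq_sym oner_eq0.
Qed.

Lemma axis_submodule n : submodule (axis n).
Proof.
apply/submoduleP; split=> // a u v au av i ni.
by rewrite -[LHS]/(a i * u i + v i) au// av// mulr0 addr0.
Qed.

Lemma axis_sub (N : set A^o) (f : A) n :
  submodule N -> N f -> f n <> 0 -> axis n `<=` N.
Proof.
move=> Nsub Nf /eqP fn0 g ag.
(* The divisor is the fixed scalar [f n]: away from [n] the numerator [g i] is already zero,
   whatever [f i] is. *)
have -> : g = (fun i => g i / f n) *: (f : A^o).
  apply/funext => i; rewrite -[RHS]/(g i / f n * f i).
  by have [->|/eqP/ag->] := eqVneq i n; rewrite ?divfK// !mul0r.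
exact: submodule_scale.
Qed.

Lemma axis_simple n : simple_submodule (axis n).
Proof.
split; first exact: axis_submodule.
- apply/nonzero_submoduleP; first exact: axis_submodule.
  exists (unit_seq n) => [i /eqP/negPf ni|]; first by rewrite /unit_seq ni.
  move=> /(congr1 (fun g : A => g n)) /eqP.
  by rewrite /unit_seq eqxx oner_eq0.
move=> T Tsub Tn; have [|Tn0] := pselect (T = [set 0]); [by left|right].
apply/seteqP; split=> //.
have /(nonzero_submoduleP _ Tsub)[f Tf fn0] := Tn0.
(* A nonzero element of the axis must be nonzero at [n], so [T] contains the whole axis. *)
apply: (axis_sub _ f) => // fn; apply: fn0; apply/funext => i.
by have [->//|/eqP] := eqVneq i n; exact: Tn.
Qed.

Lemma sequence_ring_SM : SM A^o.
Proof.
move=> N Nsub /(nonzero_submoduleP _ Nsub)[f Nf fn0].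
have [n fn] : exists n, f n <> 0.
  apply: contrapT => no; apply: fn0; apply/funext => n.
  by apply: contrapT => fn; apply: no; exists n.
by exists (axis n); [exact: axis_simple|exact: axis_sub Nf fn].
Qed.

Lemma sequence_ring_not_artinian : ~ artinian A^o.
Proof.
move=> art; pose C k : set A^o := [set f | forall i, (i < k)%N -> f i = 0].
have Csub k : submodule (C k).
  apply/submoduleP; split=> // a u v Cu Cv i ik.
  by rewrite -[LHS]/(a i * u i + v i) Cu// Cv// mulr0 addr0.
have Cdec k : C k.+1 `<=` C k by move=> f Cf i ik; apply: Cf; exact: ltnW.
have [n /(_ n.+1 (leqnSn n)) Cn] := art C Csub Cdec.
(* [unit_seq n] vanishes below [n] but not at [n], which separates [C n] from [C n.+1]. *)
have : C n (unit_seq n) by move=> i; rewrite /unit_seq; case: ltngtP.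
by rewrite -Cn => /(_ n (ltnSn n)) /eqP; rewrite /unit_seq eqxx oner_eq0.
Qed.

Lemma sequence_ring_not_locally_finite : ~ locally_finite A^o.
Proof.
move=> lf; pose G := smallest submodule [set (1 : A^o)].
have Gfin : finite_set G by apply: lf; exists [set 1] => //; exact: finite_set1.
have GT (f : A) : G f.
  have -> : f = f *: (1 : A^o) by rewrite [RHS]mulr1.
  apply: (submodule_scale _ _ _ (submodule_smallest _)).
  exact: sub_gen_smallest.
(* The injective family [unit_seq] takes all its values in [G], so finiteness of [G] would make
   [nat] finite. *)
apply: infinite_nat; apply: sub_finite_set (finite_preimage _ Gfin).
  by move=> n _; exact: (GT (unit_seq n)).
by move=> m n _ _; exact: unit_seq_inj.
Qed.

End SequenceRing.

Theorem theorem3p3 :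
  ((forall (R : nzRingType) (M : lmodType R),
      ~ is_field R -> artinian M -> SM M) /\
   (exists (R : nzRingType) (M : lmodType R),
      [/\ ~ is_field R, SM M & ~ artinian M])) /\
  ((forall (R : nzRingType) (M : lmodType R),
      ~ is_field R -> locally_finite M -> SM M) /\
   (exists (R : nzRingType) (M : lmodType R),
      [/\ ~ is_field R, SM M & ~ locally_finite M])) /\
  ((forall (R : nzRingType) (M : lmodType R),
      ~ is_field R -> finite_length M -> SM M) /\
   (exists (R : nzRingType) (M : lmodType R),
      [/\ ~ is_field R, SM M & ~ finite_length M])).
Proof.
(* Any field of coefficients would do; [rat] is a concrete choice. *)
pose A : nzRingType := nat -> rat.
have Anf : ~ is_field A := sequence_ring_not_field rat.
have ASM : SM A^o := sequence_ring_SM rat.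
have Anart : ~ artinian A^o := sequence_ring_not_artinian rat.
split; [|split]; split.
- by move=> R M _; exact: artinian_SM.
- by exists A, A^o.
- by move=> R M _; exact: locally_finite_SM.
- by exists A, A^o; split=> //; exact: sequence_ring_not_locally_finite.
- by move=> R M _ /finite_length_artinian; exact: artinian_SM.
- by exists A, A^o; split=> // /finite_length_artinian.
Qed.
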